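(* Let $\kappa\in(0,1]$ and $\epsilon>0$. No (possibly randomized) polynomial-time algorithm with value-oracle access achieves an approximation factor strictly better than $\frac{n^{2/3-\epsilon}}{1+(n^{2/3-\epsilon}-1)(1-\kappa)}$ for the shortest submodular $s$-$t$ path problem on functions of curvature $\kappa$: given a graph $\mathcal G=(\mathcal V,\mathcal E)$ with $n=|\mathcal V|$ vertices, two distinct vertices $s,t$, and a nonnegative monotone submodular $f:2^{\mathcal E}\to\mathbb{R}$ with $f(\emptyset)=0$ and curvature $\kappa$, find an $s$-$t$ path $X\subseteq\mathcal E$ minimizing $f(X)$.
   Context: In the value-oracle model the algorithm accesses $f$ only by queries returning $f(S)$; polynomial-time means polynomial in the size of the graph. Curvature: $\kappa_f = 1-\min_{e\in\mathcal E}\frac{f(e\mid \mathcal E\setminus\{e\})}{f(\{e\})}$ with $f(e\mid S)=f(S\cup\{e\})-f(S)$. *)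

(* Defs.v *)
From HB Require Import structures.
From mathcomp Require Import all_boot all_order all_algebra.
From mathcomp Require Import all_classical all_reals all_analysis.

Set Implicit Arguments.
Unset Strict Implicit.
Unset Printing Implicit Defensive.

Import Order.TTheory GRing.Theory Num.Theory.
Local Open Scope ring_scope.

(* A finite graph with vertices ['I_nv] and edges ['I_ne]: the labelling is the
   one under which the graph is presented to an algorithm. *)
Record graph := Graph {
  nv : nat;
  ne : nat;
  ends : 'I_ne -> 'I_nv * 'I_nv
}.

(* Each undirected edge is stored once, with its smaller endpoint first; this
   excludes loops, and injectivity excludes parallel edges. *)
Definition simple_graph (G : graph) : Prop :=
  (forall e : 'I_(ne G), ((ends e).1 < (ends e).2)%N) /\
  injective (@ends G).

Definition joins (G : graph) (e : 'I_(ne G)) (u v : 'I_(nv G)) : bool :=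
  (ends e == (u, v)) || (ends e == (v, u)).

Definition adjacent (G : graph) : rel 'I_(nv G) :=
  fun u v => [exists e, joins e u v].

(* [X] is the edge set of a path with pairwise distinct vertices [s :: p]; the
   entries of [zip (s :: p) p] are the pairs of consecutive vertices. *)
Definition is_st_path (G : graph) (s t : 'I_(nv G)) (X : {set 'I_(ne G)}) :
    Prop :=
  exists p : seq 'I_(nv G),
    [/\ uniq (s :: p), path (@adjacent G) s p, last s p = t &
        X = [set e | has (fun uv => joins e uv.1 uv.2) (zip (s :: p) p)]].

Section SetFunctions.
Context {R : realType} {E : finType}.
Implicit Type f : {set E} -> R.

Definition nonnegative f : Prop := forall A : {set E}, 0 <= f A.

Definition monotone f : Prop := forall A B : {set E}, A \subset B -> f A <= f B.

Definition submodular f : Prop :=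
  forall A B : {set E}, f (A :|: B) + f (A :&: B) <= f A + f B.

Definition marginal f (e : E) (S : {set E}) : R := f (e |: S) - f S.

(* When [f] is submodular with [f set0 = 0] and every [f [set e]] is positive,
   all the quotients are at most 1, so the default value 1 of the minimum only
   matters if there is no edge. *)
Definition curvature f : R :=
  1 - \big[Num.min/1]_(e : E) (marginal f e [set~ e] / f [set e]).

End SetFunctions.

Record instance (R : realType) := Instance {
  gr : graph;
  src : 'I_(nv gr);
  tgt : 'I_(nv gr);
  cost : {set 'I_(ne gr)} -> R
}.

(* Positivity of the singletons is what makes the quotients in the definition
   of the curvature meaningful. *)
Definition admissible (R : realType) (kappa : R) (I : instance R) : Prop :=
  [/\ simple_graph (gr I), src I != tgt I &
      exists X, is_st_path (src I) (tgt I) X] /\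
  [/\ nonnegative (cost (i := I)), monotone (cost (i := I)),
      submodular (cost (i := I)) & cost (i := I) finset.set0 = 0] /\
  (forall e, 0 < cost (i := I) [set e]) /\ curvature (cost (i := I)) = kappa.

Definition is_optimal (R : realType) (I : instance R)
    (Y : {set 'I_(ne (gr I))}) : Prop :=
  is_st_path (src I) (tgt I) Y /\
  forall Z, is_st_path (src I) (tgt I) Z -> cost Y <= cost Z.

Definition graph_size (R : realType) (I : instance R) : nat :=
  (nv (gr I) + ne (gr I))%N.

(* Algorithms are programs of a random access machine with a memory of natural
   numbers and, since oracle answers are real numbers, a memory of real numbers.
   Every instruction takes one unit of time.  There is no multiplication on the
   natural numbers, so that they keep polynomially many bits in polynomial time.
   [d], [a], [b] are memory addresses and [l] is a program line.
     NLoad d a:  N[d] := N[N[a]]      NStore a b:  N[N[a]] := N[b]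
     RLoad d a:  R[d] := R[N[a]]      RStore a b:  R[N[a]] := R[b]
     NJumpLe, RJumpLe a b l:  go to l if the content of a is <= that of b
     Flip d:     N[d] := a fresh fair coin
     Query d a:  R[d] := f(S), S being the edge set whose characteristic vector
                 is stored in the natural memory from address N[a] on
     Halt a:     stop with the edge set stored from address N[a] on. *)
Inductive instr (R : Type) : Type :=
| NConst (d k : nat)
| NAdd (d a b : nat)
| NSub (d a b : nat)
| NLoad (d a : nat)
| NStore (a b : nat)
| NJumpLe (a b l : nat)
| RConst (d : nat) (r : R)
| RAdd (d a b : nat)
| RSub (d a b : nat)
| RMul (d a b : nat)
| RDiv (d a b : nat)
| RLoad (d a : nat)
| RStore (a b : nat)
| RJumpLe (a b l : nat)
| Flip (d : nat)
| Query (d a : nat)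
| Halt (a : nat).

Definition program (R : Type) := seq (instr R).

Record config (R : Type) := Config {
  pc : nat;
  nmem : nat -> nat;
  rmem : nat -> R
}.

Definition upd (T : Type) (M : nat -> T) (d : nat) (v : T) : nat -> T :=
  fun i => if i == d then v else M i.

Definition read_set (m : nat) (M : nat -> nat) (a : nat) : {set 'I_m} :=
  [set e : 'I_m | M (a + e)%N != 0%N].

Section Machine.
Context {R : realType}.

Definition init (I : instance R) : config R :=
  Config 0
    (nth 0%N [:: nv (gr I), ne (gr I), nat_of_ord (src I), nat_of_ord (tgt I) &
      flatten [seq [:: nat_of_ord (ends e).1; nat_of_ord (ends e).2]
              | e <- enum 'I_(ne (gr I))]])
    (fun=> 0).

(* One step, [coin] being used by [Flip] only.  A halted machine stays as it is,
   and so does one that leaves the program, which never counts as halted. *)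
Definition step (P : program R) (m : nat) (f : {set 'I_m} -> R)
    (c : config R) (coin : bool) : config R :=
  let: Config i N M := c in
  let setN d v := Config i.+1 (upd N d v) M in
  let setR d v := Config i.+1 N (upd M d v) in
  match onth P i with
  | None => c
  | Some ins =>
    match ins with
    | NConst d k => setN d k
    | NAdd d a b => setN d (N a + N b)%N
    | NSub d a b => setN d (N a - N b)%N
    | NLoad d a => setN d (N (N a))
    | NStore a b => setN (N a) (N b)
    | NJumpLe a b l => Config (if (N a <= N b)%N then l else i.+1) N M
    | RConst d r => setR d r
    | RAdd d a b => setR d (M a + M b)
    | RSub d a b => setR d (M a - M b)
    | RMul d a b => setR d (M a * M b)
    | RDiv d a b => setR d (M a / M b)
    | RLoad d a => setR d (M (N a))
    | RStore a b => setR (N a) (M b)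
    | RJumpLe a b l => Config (if M a <= M b then l else i.+1) N M
    | Flip d => setN d (nat_of_bool coin)
    | Query d a => setR d (f (read_set m N (N a)))
    | Halt _ => c
    end
  end.

Definition halted (P : program R) (c : config R) : bool :=
  if onth P (pc c) is Some (Halt _) then true else false.

(* The run has one step per entry of [coins]. *)
Definition run (P : program R) (I : instance R) (coins : seq bool) : config R :=
  foldl (step P (cost (i := I))) (init I) coins.

Definition output (P : program R) (I : instance R) (coins : seq bool) :
    {set 'I_(ne (gr I))} :=
  let c := run P I coins in
  if onth P (pc c) is Some (Halt a) then read_set _ (nmem c) (nmem c a)
  else finset.set0.

Definition polynomially_bounded (T : nat -> nat) : Prop :=
  exists c k : nat, forall x, (T x <= c * x ^ k + c)%N.

Definition runs_in_time (kappa : R) (P : program R) (T : nat -> nat) : Prop :=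
  forall I : instance R, admissible kappa I ->
  forall coins : (T (graph_size I)).-tuple bool, halted P (run P I coins).

(* Expectation and probability for [n] independent fair coins. *)
Definition expectation_coins (n : nat) (F : n.-tuple bool -> R) : R :=
  (\sum_(w : n.-tuple bool) F w) / 2 ^+ n.

Definition probability_coins (n : nat) (A : n.-tuple bool -> Prop) : R :=
  expectation_coins (fun w => (`[< A w >])%:R).

Definition achieves_in_expectation (kappa : R) (P : program R) (T : nat -> nat)
    (alpha : nat -> R) : Prop :=
  forall I : instance R, admissible kappa I ->
    (forall coins : (T (graph_size I)).-tuple bool,
       is_st_path (src I) (tgt I) (output P I coins)) /\
    forall Y : {set 'I_(ne (gr I))}, is_optimal Y ->
      expectation_coins (fun coins : (T (graph_size I)).-tuple bool =>
        cost (output P I coins)) <= alpha (nv (gr I)) * cost Y.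

Definition achieves_with_probability (p kappa : R) (P : program R)
    (T : nat -> nat) (alpha : nat -> R) : Prop :=
  forall I : instance R, admissible kappa I ->
    forall Y : {set 'I_(ne (gr I))}, is_optimal Y ->
      p <= probability_coins (fun coins : (T (graph_size I)).-tuple bool =>
        is_st_path (src I) (tgt I) (output P I coins) /\
        cost (output P I coins) <= alpha (nv (gr I)) * cost Y).

(* The two usual meanings of an approximation guarantee for a randomized
   algorithm; they coincide for a program without [Flip]. *)
Definition achieves_factor (kappa : R) (P : program R) (T : nat -> nat)
    (alpha : nat -> R) : Prop :=
  achieves_in_expectation kappa P T alpha \/
  exists2 p : R, 0 < p & achieves_with_probability p kappa P T alpha.

End Machine.

(* Main.v *)
Require Import Defs.
From HB Require Import structures.
From mathcomp Require Import all_boot all_order all_algebra.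
From mathcomp Require Import all_classical all_reals all_analysis.
From mathcomp Require Import zify ring lra.

(* A layered graph has [H = m ^ (2b+1)] expensive layers, each a complete
   bipartite graph between two levels of [W = m ^ (b+1)] vertices, separated by
   cheap layers.  A hidden s-t path uses one uniformly random edge in each
   expensive layer, independently.  The easy cost charges the number of
   expensive edges truncated at [H]; the hard cost first counts the hidden edges
   only up to [beta].  (Both are mixed with the modular cost of weight
   [1 - kappa] to get curvature [kappa].)  A query tells the two costs apart only
   if it has fewer than [2 H] expensive edges and more than [beta] of them are
   hidden.  As each edge is hidden with probability [W ^ -2] and
   [2 H / W ^ 2 = 2 / m], an exponential moment bounds the probability of this by
   a constant times [m ^ -(beta+1)].  With [beta] a large constant, this beats the
   polynomial number of queries, so the run on a suitable hard instance is for
   most coins the run on the easy one.  The output then costs at least [H], the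
   hidden path only about [(1 - kappa) H + kappa beta], and [H] is about
   [n ^ (2/3)] up to an arbitrarily small power of [n]. *)

Set Implicit Arguments.
Unset Strict Implicit.
Unset Printing Implicit Defensive.

Import Order.TTheory GRing.Theory Num.Theory.
Local Open Scope ring_scope.

(** * Tail bound *)

Lemma prod1D_le_expR (R : realType) (I : finType) (a : I -> R) :
  (forall i, 0 <= a i) -> \prod_i (1 + a i) <= expR (\sum_i a i).
Proof.
move=> a0; rewrite expR_sum; apply: ler_prod => i _.
by rewrite addr_ge0 ?expR_ge1Dx.
Qed.

(** Markov's inequality for the exponential moment [(1 + x) ^+ hits] under a uniform [phi]: the
    coordinates are independent, so the moment factorises, and [1 + a <= expR a] bounds the
    product. *)
Lemma card_fun_hits_le (R : realType) (I B : finType) (Q : {set I * B})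
    (x : R) (t : nat) :
  0 <= x -> (0 < #|B|)%N ->
  #|[set phi : {ffun I -> B} | (t <= #|[set i | (i, phi i) \in Q]|)%N]|%:R
    * (1 + x) ^+ t <=
  expR (x * #|Q|%:R / #|B|%:R) * #|{ffun I -> B}|%:R.
Proof.
move=> x0 B0.
have B0' : 0 < #|B|%:R :> R by rewrite ltr0n.
pose F (i : I) (b : B) : R := if (i, b) \in Q then 1 + x else 1.
have F1 i b : 1 <= F i b by rewrite /F; case: ifP; rewrite ?lexx // lerDl.
apply: (@le_trans _ _ (\sum_(phi : {ffun I -> B}) \prod_i F i (phi i))).
  rewrite -sum1_card natr_sum mulr_suml.
  rewrite [leRHS](bigID (mem [set phi : {ffun I -> B} |
    (t <= #|[set i | (i, phi i) \in Q]|)%N])) /=.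
  rewrite -[leLHS]addr0 lerD //.
    apply: ler_sum => phi; rewrite inE cardsE => ht.
    rewrite mul1r (bigID (fun i => (i, phi i) \in Q)) /=.
    rewrite [X in _ <= _ * X]big1 ?mulr1; last first.
      by move=> i /negPf; rewrite /F => ->.
    rewrite (eq_bigr (fun=> 1 + x)); last by move=> i; rewrite /F => ->.
    by rewrite prodr_const ler_weXn2l // lerDl.
  apply: sumr_ge0 => phi _; apply: prodr_ge0 => i _.
  exact: le_trans ler01 (F1 _ _).
rewrite -bigA_distr_bigA /=.
have sumF i : \sum_b F i b = #|B|%:R * (1 + x * #|[set b | (i, b) \in Q]|%:R / #|B|%:R).
  rewrite (eq_bigr (fun b => 1 + x * ((i, b) \in Q)%:R)); last first.
    by move=> b _; rewrite /F; case: ifP; rewrite ?mulr1 ?mulr0 ?addr0.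
  rewrite big_split /= sumr_const -mulr_sumr -natr_sum -big_mkcond /= sum1_card.
  rewrite mulrDr mulr1 mulrCA mulfV ?gt_eqF // mulr1 cardsE.
  by [].
under eq_bigr do rewrite sumF.
rewrite big_split /= prodr_const card_ffun natrX mulrC ler_wpM2r //.
apply: le_trans (prod1D_le_expR _) _.
  by move=> i; rewrite divr_ge0 // mulr_ge0.
rewrite ler_expR -mulr_suml ler_wpM2r ?invr_ge0 ?ler0n //.
rewrite -mulr_sumr ler_wpM2l // -natr_sum ler_nat.
(* Split [Q] into its fibres over the first coordinate. *)
rewrite -sum1_card (partition_big fst xpredT) //=.
apply: leq_sum => i _.
rewrite sum1_card.
apply: leq_trans (leq_imset_card snd _).
apply: subset_leq_card; apply/fintype.subsetP => b /= ib.
apply/imsetP; exists (i, b) => //.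
by rewrite inE in ib; rewrite unfold_in /= ib eqxx.
Qed.

(** * Hidden cost function *)

Section HiddenCost.
Context {R : realType} {E : finType}.
Implicit Types M H X Y : {set E}.

(** Rank function of a laminar matroid: at most [beta] elements of [M :&: H], at most [h] of [M],
    none outside [M]. *)
Definition capped M H (beta h : nat) X : nat :=
  minn (minn #|X :&: M| (beta + #|(X :&: M) :\: H|)) h.

Definition hidden_cost (kappa eta : R) M H (beta h : nat) X : R :=
  eta * #|X :\: M|%:R + (1 - kappa) * #|X :&: M|%:R
  + kappa * (capped M H beta h X)%:R.

Definition plain_cost (kappa eta : R) M (h : nat) X : R :=
  eta * #|X :\: M|%:R + (1 - kappa) * #|X :&: M|%:R
  + kappa * (minn #|X :&: M| h)%:R.

Lemma cardsI_modular M X Y :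
  (#|(X :|: Y) :&: M| + #|(X :&: Y) :&: M| = #|X :&: M| + #|Y :&: M|)%N.
Proof.
rewrite finset.setIUl; have -> : (X :&: Y) :&: M = (X :&: M) :&: (Y :&: M).
  by rewrite finset.setIACA finset.setIid.
by rewrite cardsUI.
Qed.

Lemma cardsD_modular M X Y :
  (#|(X :|: Y) :\: M| + #|(X :&: Y) :\: M| = #|X :\: M| + #|Y :\: M|)%N.
Proof. by rewrite !finset.setDE cardsI_modular. Qed.

Lemma capped_mono M H beta h X Y :
  X \subset Y -> (capped M H beta h X <= capped M H beta h Y)%N.
Proof.
move=> XY; have XM := subset_leq_card (finset.setSI M XY).
have := subset_leq_card (finset.setSD H (finset.setSI M XY)).
rewrite /capped; lia.
Qed.

Lemma capped_submodular M H beta h X Y :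
  (capped M H beta h (X :|: Y) + capped M H beta h (X :&: Y) <=
   capped M H beta h X + capped M H beta h Y)%N.
Proof.
(* [capped] depends only on these two counts, both modular and monotone, which reduces submodularity
   to arithmetic with minima. *)
pose a Z := #|Z :&: M :\: H|.
pose b Z := #|Z :&: (M :&: H)|.
have ab Z : #|Z :&: M| = (b Z + a Z)%N.
  by rewrite /a /b finset.setIA cardsID.
have aE Z : a Z = #|Z :&: (M :\: H)| by rewrite /a finset.setIDA.
have aUI : (a (X :|: Y) + a (X :&: Y) = a X + a Y)%N.
  by rewrite !aE cardsI_modular.
have bUI : (b (X :|: Y) + b (X :&: Y) = b X + b Y)%N by rewrite cardsI_modular.
have amono (Z T : {set E}) : Z \subset T -> (a Z <= a T)%N.
  by move=> ZT; rewrite !aE subset_leq_card ?finset.setSI.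
have bmono (Z T : {set E}) : Z \subset T -> (b Z <= b T)%N.
  by move=> ZT; rewrite subset_leq_card ?finset.setSI.
have := amono _ _ (finset.subsetUl X Y); have := amono _ _ (finset.subsetUr X Y).
have := bmono _ _ (finset.subsetUl X Y); have := bmono _ _ (finset.subsetUr X Y).
have := amono _ _ (finset.subsetIl X Y); have := amono _ _ (finset.subsetIr X Y).
have := bmono _ _ (finset.subsetIl X Y); have := bmono _ _ (finset.subsetIr X Y).
rewrite /capped !ab -/(a X) -/(a Y) -/(a (X :|: Y)) -/(a (X :&: Y)).
clear -aUI bUI; move: aUI bUI; clearbody a b.
move: (a X) (a Y) (a (X :|: Y)) (a (X :&: Y)) (b X) (b Y) (b (X :|: Y)) (b (X :&: Y)).
clear; lia.
Qed.

Section Admissible.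
Variables (kappa eta : R) (M H : {set E}) (beta h : nat).
Hypotheses (kappa_ge0 : 0 <= kappa) (kappa_le1 : kappa <= 1) (eta_gt0 : 0 < eta).
Local Notation f := (hidden_cost kappa eta M H beta h).

Lemma hidden_cost_nonnegative : nonnegative f.
Proof.
by move=> X; rewrite /hidden_cost !addr_ge0 ?mulr_ge0 ?subr_ge0 // ltW.
Qed.

Lemma hidden_cost_monotone : Defs.monotone f.
Proof.
move=> X Y XY; rewrite /hidden_cost !lerD ?ler_wpM2l ?subr_ge0 ?ler_nat //.
- exact: ltW.
- by rewrite subset_leq_card ?finset.setSD.
- by rewrite subset_leq_card ?finset.setSI.
- exact: capped_mono.
Qed.

Lemma hidden_cost_submodular : submodular f.
Proof.
move=> X Y; rewrite /hidden_cost.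
have := cardsD_modular M X Y; have := cardsI_modular M X Y.
have := capped_submodular M H beta h X Y.
rewrite -(ler_nat R) !natrD => hc.
move=> /(congr1 (fun n => n%:R : R)) + /(congr1 (fun n => n%:R : R)).
rewrite !natrD => hI hD.
have := ler_wpM2l kappa_ge0 hc.
have := congr1 ( *%R eta) hD; have := congr1 ( *%R (1 - kappa)) hI.
rewrite !mulrDr; lra.
Qed.

Lemma hidden_cost0 : f finset.set0 = 0.
Proof.
by rewrite /hidden_cost /capped finset.set0D finset.set0I cards0 !min0n !mulr0 !addr0.
Qed.

Hypotheses (beta_gt0 : (0 < beta)%N) (h_gt0 : (0 < h)%N).

Lemma hidden_cost1 e : f [set e] = if e \in M then 1 else eta.
Proof.
rewrite /hidden_cost /capped; case: ifPn => eM.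
  have -> : [set e] :\: M = finset.set0.
    by apply/eqP; rewrite finset.setD_eq0 finset.sub1set.
  have -> : [set e] :&: M = [set e] by apply/finset.setIidPl; rewrite finset.sub1set.
  rewrite cards0 cards1 mulr0 add0r mulr1.
  have -> : minn (minn 1 (beta + #|[set e] :\: H|)) h = 1%N by lia.
  by rewrite mulr1 subrK.
have -> : [set e] :&: M = finset.set0.
  by apply/eqP; rewrite finset.setI_eq0 disjoints1.
have -> : [set e] :\: M = [set e].
  by apply/finset.setDidPl; rewrite disjoints1.
by rewrite cards0 cards1 min0n min0n mulr1 !mulr0 !addr0.
Qed.

Hypothesis (H_small : (h < #|M :\: H|)%N).

(** More than [h] edges of [M] avoid [H], so the capped part is already saturated without [e], and
    only the modular part has a marginal. *)
Lemma hidden_marginal e :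
  marginal f e [set~ e] = if e \in M then 1 - kappa else eta.
Proof.
rewrite /marginal /hidden_cost finset.setUCr.
have cT : capped M H beta h finset.setT = h.
  rewrite /capped finset.setTI.
  by have := subset_leq_card (finset.subsetDl M H); lia.
have ce : capped M H beta h (~: [set e]) = h.
  rewrite /capped finset.setIC -finset.setDE.
  have := cardsD1 e M; have := cardsD1 e (M :\: H).
  have -> : M :\ e :\: H = M :\: H :\ e.
    by rewrite finset.setDDl finset.setUC -finset.setDDl.
  have := subset_leq_card (finset.subsetDl M H).
  have := subset_leq_card (finset.setSD [set e] (finset.subsetDl M H)).
  by case: (e \in M); case: (e \in M :\: H); lia.
rewrite cT ce finset.setTI finset.setTD.
rewrite [~: [set e] :&: M]finset.setIC -finset.setDE.
have -> : ~: [set e] :\: M = ~: M :\ e by rewrite !finset.setDE finset.setIC.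
have := cardsD1 e M; have := cardsD1 e (~: M).
rewrite finset.in_setC.
case: ifP => _ /= -> ->; rewrite ?natrD; ring.
Qed.

Lemma curvature_hidden_cost : curvature f = kappa.
Proof.
rewrite /curvature; suff -> : \big[Num.min/1]_(e : E)
    (marginal f e [set~ e] / f [set e]) = 1 - kappa by ring.
have fE e : marginal f e [set~ e] / f [set e] = if e \in M then 1 - kappa else 1.
  by rewrite hidden_marginal hidden_cost1; case: ifP; rewrite ?divr1 ?divff ?gt_eqF.
apply/eqP; rewrite eq_le; apply/andP; split.
  have /card_gt0P[e] : (0 < #|M :\: H|)%N by lia.
  rewrite finset.in_setD => /andP[_ eM].
  by rewrite (bigD1 e) //= fE eM ge_min lexx.
apply: le_bigmin => [|e _]; first by rewrite gerBl.
rewrite fE; case: ifP => _ /=; rewrite ?lexx ?gerBl //.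
Qed.

Lemma hidden_cost1_gt0 e : 0 < f [set e].
Proof. by rewrite hidden_cost1; case: ifP. Qed.

End Admissible.

(** In the first case the cap [beta] does not bind; in the second, at least [h] units remain even
    after capping the hidden edges, so both costs are truncated at [h]. *)
Lemma hidden_cost_eq_plain kappa eta M H beta h X :
  (#|X :&: M :&: H| <= beta)%N \/ (h + #|H| <= #|X :&: M| + beta)%N ->
  hidden_cost kappa eta M H beta h X = plain_cost kappa eta M h X.
Proof.
rewrite /hidden_cost /plain_cost /capped => hyp; congr (_ + _ * _%:R).
have := cardsID H (X :&: M); have := subset_leq_card (finset.subsetIr (X :&: M) H).
by lia.
Qed.

End HiddenCost.

(** * Layered graph *)

(** Discrete intermediate value theorem: levels may drop but rise by at most one per step, so the
    first step above [l] goes from [l] to [l.+1]. *)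
Lemma path_crosses (T : eqType) (a : rel T) (lv : T -> nat) (l : nat) s p :
  (forall u v, a u v -> (lv v <= (lv u).+1)%N) ->
  path a s p -> (lv s <= l)%N -> (l < lv (last s p))%N ->
  exists u v, [/\ (u, v) \in zip (s :: p) p, a u v, lv u = l & lv v = l.+1].
Proof.
move=> al; elim: p s => [|v p IH] s /=; first by lia.
move=> /andP[sv pv] ls ll.
have [vl|lv'] := leqP (lv v) l.
  have [u [u' [uu' auu' lu lu']]] := IH v pv vl ll.
  by exists u, u'; split; rewrite // in_cons uu' orbT.
have := al _ _ sv => lvs.
by exists s, v; split; rewrite ?in_cons ?eqxx //; lia.
Qed.

Section Layered.
(* There are [h.+1] expensive layers, hence [h.+2.*2] levels, and [w.+1] vertices
   on each level; vertex [x] is the [x %% w.+1]-th one of level [x %/ w.+1]. *)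
Variables h w : nat.

(* The form [_.-1.+1] is what [inord] needs. *)
Definition layered_order : nat := (h.+2.*2 * w.+1).-1.+1.

Lemma layered_orderE : layered_order = (h.+2.*2 * w.+1)%N.
Proof. by rewrite /layered_order prednK // muln_gt0 double_gt0. Qed.

Definition lev (x : nat) : nat := (x %/ w.+1)%N.
Definition pos (x : nat) : nat := (x %% w.+1)%N.

Definition vtx (l p : nat) : 'I_layered_order := inord (l * w.+1 + p).

Lemma lev_lt (x : 'I_layered_order) : (lev x < h.+2.*2)%N.
Proof. by rewrite /lev ltn_divLR // -layered_orderE. Qed.

Lemma vtx_val l p : (l < h.+2.*2)%N -> (p <= w)%N ->
  vtx l p = (l * w.+1 + p)%N :> nat.
Proof.
move=> hl hp; rewrite /vtx inordK // -/layered_order layered_orderE.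
apply: (@leq_trans (l.+1 * w.+1)); last by rewrite leq_mul2r hl orbT.
by rewrite mulSn addnC ltn_add2r.
Qed.

Lemma lev_vtx l p : (l < h.+2.*2)%N -> (p <= w)%N -> lev (vtx l p) = l.
Proof. by move=> hl hp; rewrite /lev vtx_val // divnMDl // divn_small ?addn0. Qed.

Lemma pos_vtx l p : (l < h.+2.*2)%N -> (p <= w)%N -> pos (vtx l p) = p.
Proof. by move=> hl hp; rewrite /pos vtx_val // modnMDl modn_small. Qed.

Lemma lev_pos_inj (x y : nat) : lev x = lev y -> pos x = pos y -> x = y.
Proof.
move=> hl hp.
by rewrite (divn_eq x w.+1) (divn_eq y w.+1) -/(lev x) hl -/(pos x) hp.
Qed.

Lemma pos_le x : (pos x <= w)%N.
Proof. by rewrite -ltnS ltn_mod. Qed.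

Definition layered_edges : {set 'I_layered_order * 'I_layered_order} :=
  [set uv : 'I_layered_order * 'I_layered_order | lev uv.2 == (lev uv.1).+1].

Definition layered : graph :=
  @Graph layered_order #|layered_edges| (fun e => enum_val e).

Local Notation edge := 'I_(ne layered).

Lemma lev_ends (e : edge) : lev (ends e).2 = (lev (ends e).1).+1.
Proof. by apply/eqP; have := enum_valP e; rewrite inE. Qed.

Lemma edge_exists (u v : 'I_layered_order) :
  lev v = (lev u).+1 -> exists e : edge, ends e = (u, v).
Proof.
move=> uv; have uvE : (u, v) \in layered_edges by rewrite inE uv.
by exists (enum_rank_in uvE (u, v)); rewrite /= enum_rankK_in.
Qed.

Lemma layered_simple : simple_graph layered.
Proof.
split=> [e|]; last exact: enum_val_inj.
rewrite ltnNge; apply/negP => /(leq_div2r w.+1).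
by rewrite -/(lev _) -/(lev _) lev_ends ltnn.
Qed.

Lemma joins_ends (e : edge) (u v : 'I_(nv layered)) :
  joins e u v -> ends e = (u, v) /\ lev v = (lev u).+1 \/
                 ends e = (v, u) /\ lev u = (lev v).+1.
Proof.
by move=> /orP[] /eqP ee; [left|right]; have := lev_ends e; rewrite ee.
Qed.

Lemma layered_size : (nv layered + ne layered <= layered_order + layered_order ^ 2)%N.
Proof.
rewrite leq_add2l; apply: leq_trans (max_card _) _.
by rewrite card_prod card_ord.
Qed.

Definition layered_src : 'I_(nv layered) := vtx 0 0.
Definition layered_tgt : 'I_(nv layered) := vtx h.*2.+3 0.

(** Layer [i] of expensive edges joins levels [i.*2.+1] and [i.*2.+2]. The other layers are cheap;
    as they are complete, they can link any choice of one expensive edge per layer to the source, to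
    the target and to each other. *)
Definition heavy : {set edge} := [set e | odd (lev (ends e).1)].

(** Coordinates identifying the expensive edges with pairs of a layer and an element of
    ['I_w.+1 * 'I_w.+1]; in them the hidden edges form the graph of [phi]. *)
Definition label (e : edge) : 'I_h.+1 * ('I_w.+1 * 'I_w.+1) :=
  (inord (lev (ends e).1)./2, (inord (pos (ends e).1), inord (pos (ends e).2))).

Lemma heavy_level e : e \in heavy -> lev (ends e).1 = ((label e).1).*2.+1.
Proof.
rewrite inE /label /=; have := lev_lt (ends e).2; rewrite lev_ends => hl eo.
move: (lev (ends e).1) eo hl => l eo hl.
rewrite inordK; last by lia.
by rewrite -[LHS]odd_double_half eo.
Qed.

Lemma label_inj : {in heavy &, injective label}.
Proof.
move=> e e' he he' ee'; apply: enum_val_inj.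
have hl : lev (ends e).1 = lev (ends e').1 by rewrite !heavy_level // ee'.
case: ee' => _ /(congr1 val) /= + /(congr1 val) /=.
rewrite !inordK ?ltnS ?pos_le // => h1 h2.
have E1 : (ends e).1 = (ends e').1 by apply/val_inj/lev_pos_inj.
have E2 : (ends e).2 = (ends e').2.
  by apply/val_inj/lev_pos_inj => //; rewrite !lev_ends hl.
rewrite -[LHS]/(ends e) -[RHS]/(ends e').
by rewrite (surjective_pairing (ends e)) E1 E2 -surjective_pairing.
Qed.

Lemma card_heavy : #|heavy| = (h.+1 * (w.+1 * w.+1))%N.
Proof.
rewrite -(card_in_imset label_inj).
rewrite (_ : label @: heavy = finset.setT).
  by rewrite cardsT !card_prod !card_ord.
apply/setP => -[i [x y]]; rewrite inE; apply/imsetP.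
have hi := ltn_ord i; have hx := ltn_ord x; have hy := ltn_ord y.
have l1 : (i.*2.+1 < h.+2.*2)%N by lia.
have l2 : (i.*2.+2 < h.+2.*2)%N by lia.
have [e ee] : exists e : edge, ends e = (vtx i.*2.+1 x, vtx i.*2.+2 y).
  by apply: edge_exists; rewrite !lev_vtx.
exists e; first by rewrite inE ee lev_vtx //= odd_double.
rewrite /label ee /= lev_vtx // !pos_vtx //= !inord_val.
by congr (_, _); apply: val_inj; rewrite /= uphalf_double inordK.
Qed.

Implicit Type phi : {ffun 'I_h.+1 -> 'I_w.+1 * 'I_w.+1}.

Definition hidden phi : {set edge} := [set e in heavy | phi (label e).1 == (label e).2].

Lemma hiddenP phi e :
  reflect (e \in heavy /\ phi (label e).1 = (label e).2) (e \in hidden phi).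
Proof.
rewrite /hidden finset.in_set.
by apply: (iffP andP) => -[he /eqP].
Qed.

Lemma hidden_label_inj phi : {in hidden phi &, injective (fun e => (label e).1)}.
Proof.
move=> e e' /hiddenP[he pe] /hiddenP[he' pe'] ee'.
apply: label_inj => //.
by rewrite (surjective_pairing (label e)) -pe ee' pe' -surjective_pairing.
Qed.

Lemma card_hidden phi : (#|hidden phi| <= h.+1)%N.
Proof.
rewrite -(card_in_imset (@hidden_label_inj phi)).
by apply: leq_trans (max_card _) _; rewrite card_ord.
Qed.

(** Puts hidden edges in the form of the tail bound. Each layer has at most one hidden edge, so
    counting layers loses nothing. *)
Lemma card_hidden_hits phi (Q : {set edge}) :
  (#|Q :&: heavy :&: hidden phi| <=
   #|[set i | (i, phi i) \in label @: (Q :&: heavy)]|)%N.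
Proof.
rewrite -(@card_in_imset _ _ (fun e => (label e).1)); last first.
  move=> e e' /finset.setIP[_ he] /finset.setIP[_ he'].
  exact: hidden_label_inj he he'.
apply: subset_leq_card; apply/fintype.subsetP => i /imsetP[e].
move=> /finset.setIP[eQ /hiddenP[_ pe]] ->.
by rewrite inE pe -surjective_pairing imset_f.
Qed.

Lemma path_card_heavy Z :
  is_st_path layered_src layered_tgt Z -> (h.+1 <= #|Z :&: heavy|)%N.
Proof.
move=> [p [_ pp pl ->]]; set Y := finset _.
rewrite -[h.+1]card_ord -cardsT.
apply: leq_trans (leq_imset_card (fun e => (label e).1) _).
apply: subset_leq_card; apply/fintype.subsetP => i _; apply/imsetP.
have hi := ltn_ord i.
have [u v /existsP[e uv]|||u [v [uvp /existsP[e uv] lu lv]]] :=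
  @path_crosses _ _ (fun x : 'I_(nv layered) => lev x) i.*2.+1 _ _ _ pp.
- by have [[_ ->]|[_ ->]] := joins_ends uv; rewrite // ltnW.
- by rewrite lev_vtx.
- by rewrite pl lev_vtx //; lia.
have le : lev (ends e).1 = i.*2.+1.
  have [[-> _]|[_ vu]] := joins_ends uv; first exact: lu.
  by move: vu; rewrite lu lv; lia.
have he : has (fun uv => joins e uv.1 uv.2) (zip (layered_src :: p) p).
  by apply/hasP; exists (u, v).
have eh : e \in heavy by rewrite inE le /= odd_double.
exists e; first by rewrite finset.in_setI eh inE he.
by apply/ord_inj/double_inj/succn_inj; rewrite -heavy_level.
Qed.

(** * The hidden path *)

(** Levels [i.*2.+1] and [i.*2.+2] use the two endpoints of the hidden edge [phi i]; the first and
    last levels use the positions of source and target. *)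
Definition hidden_pos phi (l : nat) : nat :=
  if (l == 0)%N || (l == h.*2.+3) then 0%N
  else if odd l then (phi (inord l./2)).1 else (phi (inord l./2.-1)).2.

Definition hidden_vtx phi (l : nat) : 'I_(nv layered) := vtx l (hidden_pos phi l).

Lemma hidden_pos_le phi l : (hidden_pos phi l <= w)%N.
Proof. by rewrite /hidden_pos; case: ifP => // _; case: ifP => _; rewrite -ltnS. Qed.

Lemma lev_hidden_vtx phi l : (l < h.+2.*2)%N -> lev (hidden_vtx phi l) = l.
Proof. by move=> hl; rewrite lev_vtx // hidden_pos_le. Qed.

Lemma pos_hidden_vtx phi l :
  (l < h.+2.*2)%N -> pos (hidden_vtx phi l) = hidden_pos phi l.
Proof. by move=> hl; rewrite pos_vtx // hidden_pos_le. Qed.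

Lemma zip_map_iota (T : Type) (r : nat -> T) k n :
  zip (r k :: [seq r l | l <- iota k.+1 n]) [seq r l | l <- iota k.+1 n] =
  [seq (r l, r l.+1) | l <- iota k n].
Proof. by elim: n k => //= n IH k; rewrite -IH. Qed.

Lemma path_map_iota (T : Type) (a : rel T) (r : nat -> T) k n :
  (forall l, (k <= l < k + n)%N -> a (r l) (r l.+1)) ->
  path a (r k) [seq r l | l <- iota k.+1 n].
Proof.
elim: n k => //= n IH k ha; rewrite ha ?IH //; last by lia.
by move=> l hl; apply: ha; lia.
Qed.

(** The path takes one vertex on each level, given by [hidden_vtx]; its edge in each expensive layer
    is then the hidden one. *)
Lemma hidden_path phi : exists Y : {set edge},
  [/\ is_st_path layered_src layered_tgt Y, Y :&: heavy \subset hidden phi &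
      (#|Y| <= h.*2.+3)%N].
Proof.
pose r := hidden_vtx phi.
pose p := [seq r l | l <- iota 1 h.*2.+3].
have r0 : layered_src = r 0%N by [].
exists [set e | has (fun uv => joins e uv.1 uv.2) (zip (layered_src :: p) p)].
have inY (e : edge) : has (fun uv => joins e uv.1 uv.2) (zip (layered_src :: p) p) ->
    exists2 l, (l < h.*2.+3)%N & ends e = (r l, r l.+1).
  rewrite r0 /p zip_map_iota => /hasP[uv /mapP[l]].
  rewrite mem_iota => /andP[_ hl] -> /joins_ends[[-> _]|[_]]; first by exists l.
  by rewrite !lev_hidden_vtx; lia.
split.
- exists p; split => //.
  + rewrite r0 (_ : _ :: p = [seq r l | l <- iota 0 h.*2.+4]) //.
    rewrite map_inj_in_uniq ?iota_uniq //.
    move=> l l'; rewrite !mem_iota => hl hl' /(congr1 (fun x : 'I__ => lev x)).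
    by rewrite !lev_hidden_vtx //; lia.
  + rewrite r0; apply: path_map_iota => l hl; apply/existsP.
    have [|e ee] := @edge_exists (r l) (r l.+1).
      by rewrite !lev_hidden_vtx //; lia.
    by exists e; rewrite /joins ee eqxx.
  + rewrite r0 /p last_map -[0%N]/(nth 0%N (iota 0 h.*2.+4) 0).
    have -> : last 0%N (iota 1 h.*2.+3) = h.*2.+3.
      by rewrite -nth_last size_iota nth_iota.
    by rewrite /r /hidden_vtx /hidden_pos eqxx orbT.
- apply/fintype.subsetP => e; rewrite finset.in_setI inE => /andP[/inY[l hl ee] eh].
  apply/hiddenP; split=> //; have := heavy_level eh; have hi := ltn_ord (label e).1.
  have -> : (label e).2 = (inord (pos (ends e).1), inord (pos (ends e).2)) by [].
  move: (label e).1 hi => i hi; rewrite ee [(_, _).1]/= lev_hidden_vtx; last by lia.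
  move=> le; rewrite !pos_hidden_vtx; try lia.
  rewrite le /hidden_pos /= odd_double /=.
  have -> : (i.*2.+1 == h.*2.+3) = false by lia.
  have -> : (i.*2.+2 == h.*2.+3) = false by lia.
  rewrite /= uphalf_double doubleK !inord_val.
  by rewrite -surjective_pairing.
(* One edge per layer: the level of the lower endpoint determines the edge. *)
- pose lv (e : edge) : 'I_h.*2.+3 := inord (lev (ends e).1).
  rewrite -[X in (_ <= X)%N]card_ord -(@card_in_imset _ _ lv); first exact: max_card.
  move=> e e'; rewrite !inE => /inY[l hl ee] /inY[l' hl' ee'].
  rewrite /lv ee ee' /= !lev_hidden_vtx; try lia.
  move=> /(congr1 val); rewrite /= !inordK // => ll'; apply: enum_val_inj.
  by rewrite -[LHS]/(ends e) -[RHS]/(ends e') ee ee' ll'.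
Qed.

End Layered.

(** * Oracle machines on indistinguishable costs *)

Section Simulation.
Context {R : realType}.
Implicit Types P : program R.

(** A step that is no query counts as a dummy query of the empty set, so that there is one entry per
    step. *)
Definition asked P (m : nat) (c : config R) : {set 'I_m} :=
  if onth P (pc c) is Some (Query _ a) then read_set m (nmem c) (nmem c a)
  else finset.set0.

Fixpoint queries P (m : nat) (f : {set 'I_m} -> R) (c : config R)
    (coins : seq bool) : seq {set 'I_m} :=
  if coins is b :: coins' then asked P m c :: queries P f (step P f c b) coins'
  else [::].

Lemma size_queries P m (f : {set 'I_m} -> R) c coins :
  size (queries P f c coins) = size coins.
Proof. by elim: coins c => //= b coins IH c; rewrite IH. Qed.

Lemma step_eq P m (f f' : {set 'I_m} -> R) c b :
  f' (asked P m c) = f (asked P m c) -> step P f' c b = step P f c b.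
Proof.
case: c => i N M; rewrite /step /asked /=.
by case: (onth P i) => [[]|] //= d a ->.
Qed.

(** [queries] follows the adaptive run with [f], so agreement on that one list forces the run with
    [f'] to coincide with it. *)
Lemma run_eq P m (f f' : {set 'I_m} -> R) c coins :
  {in queries P f c coins, f' =1 f} ->
  foldl (step P f') c coins = foldl (step P f) c coins.
Proof.
elim: coins c => //= b coins IH c ff.
rewrite (@step_eq _ _ f) ?ff ?inE ?eqxx // IH // => Q hQ.
by rewrite ff // inE hQ orbT.
Qed.

(** The output is included so that its cost, too, is the same under both functions. *)
Definition probes P (I : instance R) (coins : seq bool) : seq {set 'I_(ne (gr I))} :=
  output P I coins :: queries P (cost (i := I)) (init I) coins.

Lemma output_eq P (G : graph) (s t : 'I_(nv G)) (f f' : {set 'I_(ne G)} -> R) coins :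
  {in probes P (Instance s t f) coins, f' =1 f} ->
  output P (Instance s t f') coins = output P (Instance s t f) coins.
Proof.
move=> ff; rewrite /output /run /= [init _]/(init (Instance s t f)).
rewrite (@run_eq _ _ f) // => Q hQ; apply: ff.
by rewrite in_cons hQ orbT.
Qed.

End Simulation.

(** Averaging: count the bad pairs by [w] and by [phi]. If every [phi] exceeded the bound, so would
    the total. *)
Lemma exists_few_bad (R : realType) (Phi W : finType) (bad : Phi -> W -> bool) (d : R) :
  (0 < #|Phi|)%N ->
  (forall w, #|[set phi | bad phi w]|%:R <= d * #|Phi|%:R) ->
  exists phi, #|[set w | bad phi w]|%:R <= d * #|W|%:R.
Proof.
move=> Phi0 hw; apply: contrapT => /forallNP hphi.
have : \sum_(phi : Phi) #|[set w | bad phi w]|%:R <= \sum_(w : W) d * #|Phi|%:R.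
  apply: (@le_trans _ _ (\sum_(w : W) #|[set phi | bad phi w]|%:R)); last first.
    by apply: ler_sum => w _; exact: hw.
  rewrite -!natr_sum ler_nat eq_leq //.
  under eq_bigr do rewrite -sum1_card big_mkcond.
  rewrite exchange_big /=; apply: eq_bigr => w _.
  rewrite -sum1_card [RHS]big_mkcond /=; apply: eq_bigr => phi _.
  by rewrite !inE.
have -> : \sum_(w : W) d * #|Phi|%:R = \sum_(phi : Phi) d * #|W|%:R.
  by rewrite !sumr_const -[LHS]mulr_natr -[RHS]mulr_natr mulrAC.
rewrite leNgt => /negP; apply.
apply: ltr_sum; last by move=> phi _; rewrite ltNge; apply/negP/hphi.
by have /card_gt0P[phi _] := Phi0; apply/hasP; exists phi; rewrite ?mem_index_enum.
Qed.

(** * Hard instances *)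

Lemma exists_optimal (R : realType) (I : instance R) :
  (exists X, is_st_path (src I) (tgt I) X) -> exists Y, is_optimal (I := I) Y.
Proof.
move=> [X hX]; pose p (Z : {set 'I_(ne (gr I))}) := `[< is_st_path (src I) (tgt I) Z >].
have pX : p X by apply/asboolP.
case: (@arg_minP _ _ _ X p (cost (i := I)) pX) => Y /asboolP hY Ymin.
by exists Y; split=> // Z hZ; apply: Ymin; apply/asboolP.
Qed.

Section HardInstances.
Context {R : realType}.
Variables (kappa : R) (h w beta : nat).
Hypotheses (kappa_gt0 : 0 < kappa) (kappa_le1 : kappa <= 1).
Hypotheses (w_gt0 : (0 < w)%N) (beta_gt0 : (0 < beta)%N).

Local Notation G := (layered h w).
Local Notation s := (layered_src h w).
Local Notation t := (layered_tgt h w).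
Local Notation hiding := {ffun 'I_h.+1 -> 'I_w.+1 * 'I_w.+1}.
Implicit Types (phi : hiding) (Q Z : {set 'I_(ne G)}).

(* The cheap edges of a hidden path cost at most [kappa] in total. *)
Let eta : R := kappa / h.*2.+3%:R.

Let eta_gt0 : 0 < eta.
Proof. by rewrite divr_gt0 // ltr0n. Qed.

Definition hard_cost phi : {set 'I_(ne G)} -> R :=
  hidden_cost kappa eta (heavy h w) (hidden phi) beta h.+1.

Definition easy_cost : {set 'I_(ne G)} -> R := plain_cost kappa eta (heavy h w) h.+1.

Definition hard phi : instance R := Instance s t (hard_cost phi).
Definition easy : instance R := Instance s t easy_cost.

Lemma hard_admissible phi : admissible kappa (hard phi).
Proof.
(* At most [h.+1] of the [h.+1 * w.+1 ^ 2] expensive edges are hidden and [w.+1 >= 2], so at least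
   [3 * h.+1] are not. *)
have H_small : (h.+1 < #|heavy h w :\: hidden phi|)%N.
  have := cardsID (hidden phi) (heavy h w); rewrite card_heavy.
  have := card_hidden phi.
  have := subset_leq_card (finset.subsetIr (heavy h w) (hidden phi)).
  move: w_gt0; nia.
split; last split; [split|split|split].
- exact: layered_simple.
- rewrite /=; apply/negP => /eqP /(congr1 (fun x : 'I_(nv G) => lev w x)).
  by rewrite !lev_vtx // doubleS.
- by have [Y [hY _ _]] := hidden_path phi; exists Y.
- exact: hidden_cost_nonnegative (ltW kappa_gt0) kappa_le1 eta_gt0.
- exact: hidden_cost_monotone (ltW kappa_gt0) kappa_le1 eta_gt0.
- by apply: hidden_cost_submodular => //; exact: ltW.
- exact: hidden_cost0.
- by move=> e; apply: hidden_cost1_gt0 => //; exact: ltW.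
- exact: (curvature_hidden_cost (ltW kappa_gt0) kappa_le1 eta_gt0 beta_gt0
    (ltn0Sn h) H_small).
Qed.

(** The hidden path bounds the optimum: the extra unit in [beta.+1] pays for its cheap edges, of
    total cost at most [kappa]. *)
Lemma hard_optimum phi : exists Y, is_optimal (I := hard phi) Y /\
  hard_cost phi Y <= (1 - kappa) * h.+1%:R + kappa * beta.+1%:R.
Proof.
have [X [hX XH cX]] := hidden_path phi.
have [|Y hY] := @exists_optimal _ (hard phi); first by exists X.
exists Y; split=> //; apply: le_trans (hY.2 X hX) _.
have -> : (1 - kappa) * h.+1%:R + kappa * beta.+1%:R =
    kappa + ((1 - kappa) * h.+1%:R + kappa * beta%:R).
  by rewrite -[beta.+1%:R]natr1; ring.
rewrite /= /hard_cost /hidden_cost -addrA lerD ?lerD //.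
- rewrite /eta -mulrA ger_pMr // ler_pdivrMl ?ltr0n // mulr1 ler_nat.
  exact: leq_trans (subset_leq_card (finset.subsetDl _ _)) cX.
- rewrite ler_wpM2l ?subr_ge0 // ler_nat.
  exact: leq_trans (subset_leq_card XH) (card_hidden phi).
- rewrite ler_wpM2l ?(ltW kappa_gt0) // ler_nat /capped.
  move: XH; rewrite -finset.setD_eq0 => /eqP ->; rewrite cards0 addn0.
  by rewrite geq_min geq_min leqnn orbT.
Qed.

Lemma easy_path_cost Z : is_st_path s t Z -> h.+1%:R <= easy_cost Z.
Proof.
move=> /path_card_heavy hZ; rewrite /easy_cost /plain_cost (minn_idPr hZ).
have hZ' : h.+1%:R <= #|Z :&: heavy h w|%:R :> R by rewrite ler_nat.
have e0 : 0 <= eta * #|Z :\: heavy h w|%:R by rewrite mulr_ge0 // ltW.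
have k0 : 0 <= 1 - kappa by rewrite subr_ge0.
have := ler_wpM2l k0 hZ'; lra.
Qed.

(** A query with [2 * h.+1] expensive edges or more never reveals; a smaller one must contain
    [beta.+1] hidden edges, and the tail bound applies. *)
Lemma card_revealing (x : R) Q : 0 <= x ->
  #|[set phi | hard_cost phi Q != easy_cost Q]|%:R * (1 + x) ^+ beta.+1 <=
  expR (x * (2 * h.+1%:R) / (w.+1 ^ 2)%:R) * #|{: hiding}|%:R.
Proof.
move=> x0; have [big|small] := leqP (2 * h.+1) #|Q :&: heavy h w|.
  rewrite (_ : [set phi | _] = finset.set0) ?cards0 ?mul0r ?mulr_ge0 ?expR_ge0 //.
  apply/setP => phi; rewrite !inE; apply/negbTE; rewrite negbK.
  apply/eqP/hidden_cost_eq_plain; right; have := card_hidden phi; lia.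
have cQ : (#|label (w:=w) @: (Q :&: heavy h w)| <= 2 * h.+1)%N.
  exact: leq_trans (leq_imset_card _ _) (ltnW small).
have B0 : (0 < #|{: 'I_w.+1 * 'I_w.+1}|)%N by rewrite card_prod card_ord.
have := card_fun_hits_le (label (w:=w) @: (Q :&: heavy h w)) beta.+1 x0 B0.
move=> H; apply: le_trans (le_trans _ H) _.
  rewrite ler_wpM2r ?exprn_ge0 ?addr_ge0 // ler_nat subset_leq_card //.
  apply/fintype.subsetP => phi; rewrite !inE => rev.
  apply: leq_trans (card_hidden_hits phi Q).
  rewrite ltnNge; apply: contra rev => few.
  by apply/eqP/hidden_cost_eq_plain; left.
rewrite ler_wpM2r // ler_expR card_prod card_ord -mulnn.
rewrite ler_wpM2r ?invr_ge0 // ler_wpM2l //.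
by rewrite -[2 * _](natrM R 2) ler_nat.
Qed.

(** For fixed coins the probes of the easy run do not depend on [phi], so few [phi] are revealed;
    averaging then fixes one [phi] that is good for most coins. For these the outputs and their
    costs agree. *)
Lemma fooled (P : program R) (T : nat) (x : R) : 0 <= x ->
  exists phi, exists B : {set T.-tuple bool},
    #|B|%:R <= T.+1%:R * expR (x * (2 * h.+1%:R) / (w.+1 ^ 2)%:R)
      / (1 + x) ^+ beta.+1 * 2 ^+ T /\
    forall c : T.-tuple bool, c \notin B ->
      is_st_path s t (output P (hard phi) c) ->
      h.+1%:R <= hard_cost phi (output P (hard phi) c).
Proof.
move=> x0.
pose bad phi (c : T.-tuple bool) :=
  has (fun Q => hard_cost phi Q != easy_cost Q) (probes P easy c).
have x1 : 0 < (1 + x) ^+ beta.+1 by rewrite exprn_gt0 // ltr_pwDl.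
set d := _ / _.
have [||phi hphi] := @exists_few_bad R hiding _ bad d.
- by rewrite card_ffun expn_gt0 card_prod card_ord.
- move=> c; rewrite /d mulrAC ler_pdivlMr //.
  have sz : size (probes P easy c) = T.+1 by rewrite /= size_queries size_tuple.
  (* Union bound over the [T.+1] probes. *)
  rewrite -[in T.+1%:R]sz /bad; elim: (probes P easy c) => [|Q qs IH].
    rewrite (_ : [set phi | _] = finset.set0 :> {set hiding}) /= ?cards0 ?mul0r //.
  rewrite [size _]/= -natr1 mulrDl mul1r mulrDl.
  apply: le_trans (lerD IH (card_revealing Q x0)).
  rewrite -mulrDl ler_wpM2r ?(ltW x1) // -natrD ler_nat.
  apply: leq_trans (leq_card_setU _ _); apply: subset_leq_card.
  by apply/fintype.subsetP => phi; rewrite !inE /= orbC.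
exists phi, [set c | bad phi c]; split.
  by move: hphi; rewrite card_tuple card_bool natrX.
move=> c; rewrite inE -all_predC => /allP good.
have eqf : {in probes P easy c, hard_cost phi =1 easy_cost}.
  by move=> Q /good /=; rewrite negbK => /eqP.
have := output_eq eqf; rewrite -/(hard phi) => -> hpath.
rewrite eqf; first exact: easy_path_cost.
by rewrite inE eqxx.
Qed.

End HardInstances.

(** * Choice of the parameters *)

(** With [H] expensive layers and [W] vertices per level the order is
    [2 * (H + 1) * W <= 4 * H * W], and one factor [m] absorbs the 4. *)
Lemma layered_order_le (m b : nat) : (4 <= m)%N ->
  (layered_order (m ^ b.*2.+1).-1 (m ^ b.+1).-1 <= m ^ (3 * b.+1))%N.
Proof.
move=> m4; have m0 n : (0 < m ^ n)%N by rewrite expn_gt0; lia.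
rewrite layered_orderE !prednK // -muln2.
have -> : (3 * b.+1 = 1 + (b.*2.+1 + b.+1))%N by lia.
rewrite !expnD expn1; have := m0 b.+1; have := m0 b.*2.+1.
move: (m ^ b.*2.+1)%N (m ^ b.+1)%N => H W H0 W0.
have : (4 * (H * W) <= m * (H * W))%N by rewrite leq_mul2r m4 orbT.
nia.
Qed.

(** The exponent [2 / 3 - 2 / (3 * b.+1)] turns [m ^ (3 * b.+1)] into exactly [m ^ b.*2], one factor
    [m] below the number of expensive layers. *)
Lemma powR_exponent_le (R : realType) (eps : R) (m b n : nat) :
  (0 < n)%N -> (n <= m ^ (3 * b.+1))%N -> 2 / (3 * b.+1%:R) <= eps ->
  n%:R `^ (2 / 3 - eps) <= m%:R ^+ b.*2 :> R.
Proof.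
move=> n0 nm he.
have a0 : 0 < (3 * b.+1)%:R :> R by rewrite ltr0n.
have -> : m%:R ^+ b.*2 = (m ^ (3 * b.+1))%:R `^ (2 / 3 - 2 / (3 * b.+1%:R)) :> R.
  rewrite natrX -[in RHS]powR_mulrn ?ler0n // -powRrM.
  have -> : (3 * b.+1)%:R * (2 / 3 - 2 / (3 * b.+1%:R)) = b.*2%:R :> R.
    rewrite -muln2 !natrM -!natr1; field.
    by rewrite natr1 pnatr_eq0.
  by rewrite powR_mulrn.
have e0 : 0 <= 2 / 3 - 2 / (3 * b.+1%:R) :> R.
  have b0 : 0 < 3 * b.+1%:R :> R by rewrite mulr_gt0 // ltr0n.
  by rewrite subr_ge0 ler_pM2l // lef_pV2 ?posrE ?ltr0n // ler_peMr // ler1n.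
apply: (@le_trans _ _ (n%:R `^ (2 / 3 - 2 / (3 * b.+1%:R)))).
  by rewrite ler_powR ?ler1n // lerD2l lerN2.
by rewrite ge0_ler_powR ?nnegrE ?ler0n // ler_nat.
Qed.

(** After cross-multiplication the two sides differ by [kappa * (G - g)]. *)
Lemma factor_homo (R : realType) (kappa g G : R) :
  0 < kappa -> kappa <= 1 -> 0 <= g -> g <= G ->
  g / (1 + (g - 1) * (1 - kappa)) <= G / (1 + (G - 1) * (1 - kappa)).
Proof.
move=> k0 k1 g0 gG; have G0 : 0 <= G by lra.
have den z : 0 <= z -> 0 < 1 + (z - 1) * (1 - kappa).
  move=> z0; have : 0 <= z * (1 - kappa) by rewrite mulr_ge0 ?subr_ge0.
  by lra.
rewrite ler_pdivrMr ?den // mulrAC ler_pdivlMr ?den //.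
have := ler_wpM2r (ltW k0) gG; lra.
Qed.

(** The denominator [D] is at most [G], and the spare factor [m] outweighs [beta]. The slack [kappa]
    on the right will absorb the bad coins. *)
Lemma factor_times_opt_le (R : realType) (kappa G m beta : R) :
  0 < kappa -> kappa <= 1 -> 1 <= G -> beta + 2 <= m ->
  G / (1 + (G - 1) * (1 - kappa)) *
    ((1 - kappa) * (m * G) + kappa * (beta + 1)) <= m * G - kappa.
Proof.
move=> k0 k1 G1 bm; set D := 1 + _.
have D0 : 0 < D.
  have : 0 <= (G - 1) * (1 - kappa) by rewrite mulr_ge0 ?subr_ge0.
  by rewrite /D; lra.
have DG : D <= G.
  have : 0 <= (G - 1) * kappa by rewrite mulr_ge0 ?subr_ge0 // ltW.
  by rewrite /D; lra.
rewrite mulrAC ler_pdivrMr //.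
have Dk : D * kappa <= G * kappa * (m - beta - 1).
  have h1 : D * kappa <= G * kappa by rewrite ler_wpM2r // ltW.
  have h2 : G * kappa <= G * kappa * (m - beta - 1).
    rewrite ler_peMr //; last by lra.
    by rewrite mulr_ge0 //; lra.
  exact: le_trans h1 h2.
move: Dk; rewrite /D; nra.
Qed.

(** [s <= 2 * m ^ x.*2 <= m ^ x.*2.+1], and a last factor [m >= 2 * c + 1] absorbs the constants. *)
Lemma time_bound (c k m s n x : nat) : (2 * c + 1 <= m)%N -> (2 <= m)%N ->
  (s <= n + n ^ 2)%N -> (n <= m ^ x)%N -> (0 < n)%N ->
  ((c * s ^ k + c).+1 <= m ^ ((x.*2.+1) * k).+1)%N.
Proof.
move=> cm m2 sn nm n0.
have s_le : (s <= m ^ x.*2.+1)%N.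
  apply: leq_trans sn _; rewrite [(m ^ _)%N]expnS -muln2 expnM.
  apply: leq_trans (leq_mul m2 (_ : n ^ 2 <= _)%N); first by nia.
  by rewrite leq_sqr.
have sk : (s ^ k <= m ^ (x.*2.+1 * k))%N.
  by rewrite expnM; case: k => // k; rewrite leq_exp2r.
have M0 : (0 < m ^ (x.*2.+1 * k))%N by rewrite expn_gt0; lia.
rewrite expnS; move: sk M0; move: (s ^ k)%N (m ^ _)%N => S M SM M0.
have := leq_mul cm (leqnn M); nia.
Qed.

Lemma div_bound_lt (R : realType) (C q : R) (m : nat) :
  0 < C -> 0 < q -> (Num.bound (C / q) <= m)%N -> C / m%:R < q.
Proof.
move=> C0 q0; rewrite -(ler_nat R) => hm.
have Cm : C / q < m%:R.
  by apply: lt_le_trans (archi_boundP _) hm; rewrite divr_ge0 // ltW.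
have m0 : 0 < m%:R :> R by apply: le_lt_trans Cm; rewrite divr_ge0 // ltW.
by rewrite ltr_pdivrMr // mulrC -ltr_pdivrMr.
Qed.

(** * Hard instance and lower bound *)

(** Serves both kinds of guarantee: [B] holds the bad coins, [L] bounds the cost of any path output
    otherwise, the bound by [q] is for success probabilities and the gap below [L] for
    expectations. *)
Lemma hard_instance (R : realType) (kappa eps q : R) (P : program R)
    (T : nat -> nat) (alpha : nat -> R) (N : nat) :
  0 < kappa -> kappa <= 1 -> 0 < eps -> 0 < q -> polynomially_bounded T ->
  (forall n, (N <= n)%N -> let g := n%:R `^ (2 / 3 - eps) in
     alpha n < g / (1 + (g - 1) * (1 - kappa))) ->
  exists (I : instance R) (Y : {set 'I_(ne (gr I))}) (L : R)
      (B : {set (T (graph_size I)).-tuple bool}),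
    [/\ admissible kappa I, is_optimal Y, 0 < L,
        #|B|%:R < q * 2 ^+ T (graph_size I) &
        alpha (nv (gr I)) * cost Y + L * (#|B|%:R / 2 ^+ T (graph_size I)) < L] /\
    forall coins, coins \notin B ->
      is_st_path (src I) (tgt I) (output P I coins) -> L <= cost (output P I coins).
Proof.
move=> k0 k1 e0 q0 [c [k Tck]] halpha.
have [b hb] : exists b : nat, 2 / (3 * b.+1%:R) <= eps.
  exists (Num.bound (2 / (3 * eps))).
  have b0 := archi_boundP (_ : 0 <= 2 / (3 * eps)).
  have {b0} := b0 (ltac:(by rewrite divr_ge0 // mulr_ge0 // ltW)).
  set d := Num.bound _; rewrite ltr_pdivrMr ?mulr_gt0 // => hd.
  rewrite ler_pdivrMr ?mulr_gt0 ?ltr0n // -natr1; nra.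
(* [m ^ K] will bound the number of probes. Since [beta.+1 = K + b.+1.*2], the tail beats the union
   bound and leaves [m ^- b.+1.*2]. None of these constants depends on [m]. *)
pose x := (3 * b.+1)%N; pose K := (x.*2.+1 * k).+1.
pose beta := (K + b.*2.+1)%N.
pose C : R := expR 2.
have C0 : 0 < C by exact: expR_gt0.
have [m [m4 mN mc mb [mk' mq']]] : exists m : nat,
    [/\ (4 <= m)%N, (N <= m)%N, (2 * c + 1 <= m)%N, (beta + 2 <= m)%N &
        (Num.bound (C / kappa) <= m)%N /\ (Num.bound (C / q) <= m)%N].
  move: (Num.bound _) (Num.bound _) beta => u v y.
  by exists (4 + N + (2 * c + 1) + (y + 2) + u + v)%N; split; [..|split]; lia.
have mk := div_bound_lt C0 k0 mk'.
have mq := div_bound_lt C0 q0 mq'.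
have m2 : (1 < m)%N by exact: leq_trans m4.
have m_gt0 : (0 < m)%N by exact: ltnW.
have m0 : 0 < m%:R :> R by rewrite ltr0n.
have m1 : 1 <= m%:R :> R by rewrite ler1n.
pose h := (m ^ b.*2.+1).-1; pose w := (m ^ b.+1).-1.
have hE : h.+1 = (m ^ b.*2.+1)%N by rewrite prednK // expn_gt0 m_gt0.
have wE : w.+1 = (m ^ b.+1)%N by rewrite prednK // expn_gt0 m_gt0.
have w0 : (0 < w)%N.
  by rewrite -ltnS wE; apply: leq_trans (leq_pexp2l m_gt0 (ltn0Sn b)).
have beta0 : (0 < beta)%N by rewrite /beta addnS.
have n_le : (layered_order h w <= m ^ x)%N by exact: layered_order_le.
have n0 : (0 < layered_order h w)%N by [].
have Nn : (N <= layered_order h w)%N.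
  have mM : (m <= m ^ b.*2.+1)%N.
    by have := leq_pexp2l m_gt0 (ltn0Sn b.*2); rewrite expn1.
  rewrite layered_orderE hE; apply: leq_trans mN (leq_trans mM _).
  apply: leq_trans (leq_pmulr _ (ltn0Sn w)).
  by rewrite -[_.+1.*2]addnn addSn leqW // leq_addr.
pose Tn := T (layered_order h w + #|layered_edges h w|)%N.
have Tm : (Tn.+1 <= m ^ K)%N.
  apply: leq_trans (time_bound k mc m2 (layered_size h w) n_le n0).
  by rewrite ltnS; exact: Tck.
have [phi [B [hB good]]] := @fooled R kappa h w beta k0 k1 w0 beta0 P Tn m%:R (ltW m0).
have [Y [optY costY]] := @hard_optimum R kappa h w beta k0 k1 phi.
exists (hard kappa beta phi), Y, h.+1%:R, B.
have two0 : 0 < 2 ^+ Tn :> R by rewrite exprn_gt0.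
(* With [x := m] the exponent of the tail bound is exactly 2, whence the constant [C]. *)
have fracB : #|B|%:R / 2 ^+ Tn <= C / m%:R ^+ b.+1.*2.
  rewrite ler_pdivrMr //; apply: le_trans hB _; rewrite ler_pM2r //.
  have -> : m%:R * (2 * h.+1%:R) / (w.+1 ^ 2)%:R = 2 :> R.
    rewrite hE wE -expnM muln2 doubleS !natrX !exprS; field.
    by rewrite ?mulf_neq0 ?expf_neq0 ?gt_eqF.
  rewrite -/C ler_pdivrMr ?exprn_gt0 ?ltr_pwDl //.
  have le_pow : m%:R ^+ beta.+1 <= (1 + m%:R) ^+ beta.+1 :> R.
    by rewrite lerXn2r ?nnegrE ?addr_ge0 ?ler0n // lerDr.
  have c0 : 0 <= C / m%:R ^+ b.+1.*2 by rewrite divr_ge0 ?exprn_ge0 // ltW.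
  apply: le_trans (ler_wpM2l c0 le_pow).
  have -> : beta.+1 = (b.+1.*2 + K)%N by rewrite /beta doubleS -addnS addnC.
  rewrite exprD mulrA divfK ?expf_neq0 ?gt_eqF // mulrC ler_pM2l //.
  by rewrite -natrX ler_nat.
split.
  split.
  - exact: hard_admissible.
  - exact: optY.
  - by rewrite ltr0n.
  - rewrite -ltr_pdivrMr //; apply: le_lt_trans fracB _.
    apply: le_lt_trans mq; rewrite ler_pM2l // lef_pV2 ?posrE ?exprn_gt0 //.
    by rewrite ler_eXnr.
  - have hR : h.+1%:R = m%:R * m%:R ^+ b.*2 :> R by rewrite hE natrX exprS.
    have G1 : 1 <= m%:R ^+ b.*2 :> R by rewrite exprn_ege1.
    have mbR : beta%:R + 2 <= m%:R :> R by rewrite -natrD ler_nat.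
    have := factor_times_opt_le k0 k1 G1 mbR; rewrite -hR natr1.
    set F := (X in X * _ <= _) => hF.
    have F0 : 0 <= F.
      (* At [g = 0] the smaller factor is 0. *)
      by have := factor_homo k0 k1 (lexx 0) (le_trans ler01 G1); rewrite mul0r -/F.
    have alphaF : alpha (layered_order h w) <= F.
      apply: le_trans (ltW (halpha _ Nn)) _; apply: factor_homo => //.
      exact: powR_exponent_le n0 n_le hb.
    have Y0 : 0 <= hard_cost kappa beta phi Y.
      by have [_ [[+ _ _ _] _]] := hard_admissible k0 k1 w0 beta0 phi; exact.
    have aY : alpha (layered_order h w) * hard_cost kappa beta phi Y <= h.+1%:R - kappa.
      apply: le_trans (ler_wpM2r Y0 alphaF) _; apply: le_trans hF.
      exact: ler_wpM2l.
    (* [L] is [m ^ b.*2.+1], so the loss on bad coins is at most [C / m], below the slack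
       [kappa]. *)
    have LB : h.+1%:R * (#|B|%:R / 2 ^+ Tn) < kappa.
      apply: le_lt_trans mk; apply: le_trans (ler_wpM2l _ fracB) _; first exact: ler0n.
      rewrite hE natrX doubleS !exprS [leLHS](_ : _ = C / m%:R) //.
      by field; rewrite ?mulf_neq0 ?expf_neq0 ?gt_eqF.
    by have := ler_ltD aY LB; rewrite subrK.
exact: good.
Qed.

Theorem theorem5 (R : realType) (kappa eps : R)
    (kappa_gt0 : 0 < kappa) (kappa_le1 : kappa <= 1) (eps_gt0 : 0 < eps) :
  ~ exists (P : program R) (T : nat -> nat) (alpha : nat -> R),
      [/\ polynomially_bounded T,
          runs_in_time kappa P T,
          achieves_factor kappa P T alpha &
          exists N : nat, forall n : nat, (N <= n)%N ->
            let g := n%:R `^ (2 / 3 - eps) in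
            alpha n < g / (1 + (g - 1) * (1 - kappa))].
Proof.
move=> [P [T [alpha [polyT _ + [N halpha]]]]].
case=> [hexp|[p p0 hprob]].
  (* The output costs at least 0 on [B] and at least [L] off it, so its mean is at least
     [L * (1 - #|B| / 2 ^ T)], which exceeds the guarantee. *)
  have [I [Y [L [B [[adm optY L0 _ gap] good]]]]] :=
    hard_instance P kappa_gt0 kappa_le1 eps_gt0 ltr01 polyT halpha.
  have [isp hY] := hexp I adm; have := hY Y optY; apply/negP; rewrite -ltNge.
  have two0 : 0 < 2 ^+ T (graph_size I) :> R by rewrite exprn_gt0.
  rewrite /expectation_coins ltr_pdivlMr //.
  apply: (@lt_le_trans _ _
    ((L - L * (#|B|%:R / 2 ^+ T (graph_size I))) * 2 ^+ T (graph_size I))).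
    by rewrite ltr_pM2r // ltrBrDr.
  rewrite (bigID (mem B)) /=; apply: ler_wpDl.
    by apply: sumr_ge0 => coins _; case: adm => _ [[+ _ _ _] _]; exact.
  apply: (@le_trans _ _ (\sum_(coins | coins \notin B) L)).
    rewrite sumr_const mulrBl mulrA divfK ?gt_eqF //.
    have -> : #|[pred coins | coins \notin B]| = (2 ^ T (graph_size I) - #|B|)%N.
      by rewrite -[2%N]card_bool -card_tuple -(cardC B) addKn; apply: eq_card.
    rewrite -[leRHS]mulr_natr natrB ?natrX ?mulrBr //.
    by rewrite -[2%N]card_bool -card_tuple max_card.
  by apply: ler_sum => coins hc; exact: good hc (isp coins).
(* Take [q := p]: success off [B] would need a path of cost below [L], so the success probability is
   at most that of [B], less than [p]. *)
have [I [Y [L [B [[adm optY L0 Bp gap] good]]]]] :=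
  hard_instance P kappa_gt0 kappa_le1 eps_gt0 p0 polyT halpha.
have := hprob I adm Y optY; apply/negP; rewrite -ltNge.
have two0 : 0 < 2 ^+ T (graph_size I) :> R by rewrite exprn_gt0.
rewrite /probability_coins /expectation_coins ltr_pdivrMr //.
apply: le_lt_trans Bp; rewrite -sum1_card natr_sum [leRHS]big_mkcond /=.
apply: ler_sum => coins _; case: ifPn => [_|nB]; first by case: asboolP.
case: asboolP => // -[hp hc]; have := good _ nB hp.
have : 0 <= L * (#|B|%:R / 2 ^+ T (graph_size I)).
  by rewrite mulr_ge0 ?divr_ge0 // ltW.
by move: gap hc; lra.
Qed.
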